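(* Let $\Gamma$, $\Sigma$ and $\Delta$ be graphs with the following properties. (i) $\Gamma$ is locally $\Sigma$, and every $\mu$-graph of $\Sigma$ is isomorphic to $\Delta$. (ii) $\Sigma$ is strongly regular with $\mu(\Sigma)>0$. (iii) $\Delta$ is regular, and for any $y\in V\Delta$ there exists a unique $z\in\Delta_2(y)$ such that $\Delta(y)=\Delta(z)$. (iv) $\Sigma$ has valency $\mu(\Sigma)+2\lambda(\Sigma)-2k_1(\Delta)$. Then $\Gamma$ has the unique $x$ property.
   Context: All graphs are undirected and simple with non-empty vertex set $V\Gamma$. For $u\in V\Gamma$, $\Gamma_i(u)$ is the set of vertices at distance $i$ from $u$, and $\Gamma(u)=\Gamma_1(u)$. For a regular graph $\Delta$, $k_1(\Delta)$ denotes its valency. A graph $\Gamma$ is locally $\Sigma$ if the neighbourhood of every vertex of $\Gamma$ is non-empty and induces a graph isomorphic to $\Sigma$. A strongly regular graph with parameters $(v,k,\lambda,\mu)$ is a finite graph of order $v$, regular of valency $k$ with $0<k<v-1$, in which any two adjacent vertices have $\lambda=\lambda(\Sigma)$ common neighbours and any two distinct non-adjacent vertices have $\mu=\mu(\Sigma)$ common neighbours. A $\mu$-graph of $\Sigma$ is a subgraph induced by $\Sigma(u)\cap\Sigma(w)$ for some vertices $u,w$ at distance two in $\Sigma$. A non-complete graph $\Gamma$ has the unique $x$ property if for some $u\in V\Gamma$, $v\in\Gamma(u)$ and $w\in\Gamma_2(u)\cap\Gamma(v)$, there exists a unique $x\in\Gamma(u)\cap\Gamma_2(v)$ such that $\Gamma(u)\cap\Gamma(v)\cap\Gamma(w)=\Gamma(u)\cap\Gamma(v)\cap\Gamma(x)$.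 *)

(* Defs.v *)
From mathcomp Require Import all_boot all_algebra.
From mathcomp Require Import boolp classical_sets functions cardinality.

Set Implicit Arguments.
Unset Strict Implicit.
Unset Printing Implicit Defensive.

Local Open Scope classical_set_scope.

(* Vertex sets are arbitrary types, so graphs may be infinite.  Non-emptiness
   is the separate predicate [nonempty_graph], so that induced subgraphs can be
   formed on any set of vertices. *)
Record graph := Graph {
  vertex :> Type;
  adj : vertex -> vertex -> Prop;
  adj_sym : forall x y, adj x y -> adj y x;
  adj_irrefl : forall x, ~ adj x x }.

Arguments adj {g} x y.

Definition nonempty_graph (G : graph) : Prop := [set: G] !=set0.

Definition complete_graph (G : graph) : Prop :=
  forall x y : G, x <> y -> adj x y.

Definition nbhd (G : graph) (u : G) : set G := [set v | adj u v].

Fixpoint walk (G : graph) (n : nat) (u v : G) : Prop :=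
  if n is m.+1 then exists2 t, adj u t & walk m t v else u = v.

Definition at_dist (G : graph) (n : nat) (u v : G) : Prop :=
  walk n u v /\ forall m, m < n -> ~ walk m u v.

Definition sphere (G : graph) (i : nat) (u : G) : set G :=
  [set v | at_dist i u v].

Lemma sphere1E (G : graph) (u : G) : sphere 1 u = nbhd u.
Proof.
apply/seteqP; split=> v /=; first by move=> [[t ut <-] _].
move=> uv; split=> /=; first by exists v.
by case=> // _ /= uE; rewrite -uE in uv; apply: (adj_irrefl uv).
Qed.

Lemma sphere2P (G : graph) (u v : G) :
  sphere 2 u v <-> [/\ u <> v, ~ adj u v & nbhd u `&` nbhd v !=set0].
Proof.
split=> [[/= [t ut [s ts sv]] far]|[uv nuv [t [ut vt]]]].
  rewrite sv in ts; split; first exact: (far 0).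
  - by move=> uv; apply: (far 1) => //=; exists v.
  - by exists t; split=> //; apply: adj_sym.
split=> [|[|[|//]] _ //=].
- by exists t => //; exists v => //; apply: adj_sym.
- by case=> s us sv; apply: nuv; rewrite -sv.
Qed.

Definition induced_adj (G : graph) (A : set G) (x y : set_type A) : Prop :=
  adj (val x) (val y).

Lemma induced_adj_sym (G : graph) (A : set G) (x y : set_type A) :
  induced_adj x y -> induced_adj y x.
Proof. exact: adj_sym. Qed.

Lemma induced_adj_irrefl (G : graph) (A : set G) (x : set_type A) :
  ~ induced_adj x x.
Proof. exact: adj_irrefl. Qed.

Definition induced (G : graph) (A : set G) : graph :=
  Graph (@induced_adj_sym G A) (@induced_adj_irrefl G A).

Definition graph_iso (G H : graph) : Prop :=
  exists f : G -> H, bijective f /\ forall x y, adj x y <-> adj (f x) (f y).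

Definition locally (G S : graph) : Prop :=
  forall u : G, nbhd u !=set0 /\ graph_iso (induced (nbhd u)) S.

Definition regular (G : graph) (k : nat) : Prop :=
  forall u : G, (nbhd u #= `I_k)%card.

Definition strongly_regular (G : graph) (v k lam mu : nat) : Prop :=
  [/\ ([set: G] #= `I_v)%card,
      0 < k < v - 1,
      regular G k,
      forall x y : G, adj x y -> (nbhd x `&` nbhd y #= `I_lam)%card
    & forall x y : G, x <> y -> ~ adj x y ->
        (nbhd x `&` nbhd y #= `I_mu)%card].

(* The mu-graphs of [G] are the [mu_graph u w] with [sphere 2 u w]. *)
Definition mu_graph (G : graph) (u w : G) : graph :=
  induced (nbhd u `&` nbhd w).

Definition unique_x_property (G : graph) : Prop :=
  ~ complete_graph G /\
  exists u v w : G,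
    [/\ nbhd u v,
        (sphere 2 u `&` nbhd v) w
      & exists! x : G, (nbhd u `&` sphere 2 v) x /\
          nbhd u `&` nbhd v `&` nbhd w = nbhd u `&` nbhd v `&` nbhd x].

(* Main.v *)
(** Write [N] for neighbourhoods, and take [u, w] nonadjacent in [N v]; put
    [L = N u & N v] and [D = L & N w], a copy of [Del].  For [y] in [D] with
    twin [z] in [D], the hypothesis on the valency says exactly that
    [|L| = |D \cup N_L y \cup N_L z|], so [D] consists of the vertices of [L]
    adjacent to both or neither of [y] and [z].  The mu-graph
    [M = N u & N y & N z] contains [v]; its twin [x] in [M] makes [y, z] twins
    in [L & N x], so the same count yields [L & N x = D].  Conversely any such
    [x] is the twin of [v] in [M], hence unique. *)
Require Import Defs.
From mathcomp Require Import all_boot all_algebra.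
From mathcomp Require Import boolp classical_sets functions cardinality.
From mathcomp Require Import zify.

Set Implicit Arguments.
Unset Strict Implicit.
Unset Printing Implicit Defensive.

Local Open Scope classical_set_scope.

(** * Counting in finite sets *)

Lemma card_setD_II (T : Type) (A B : set T) (n p : nat) :
  (A #= `I_n)%card -> (A `&` B #= `I_p)%card ->
  p <= n /\ (A `\` B #= `I_(n - p))%card.
Proof.
move=> An ABp.
(* [fset_set] asks for a choice structure on the elements; [{classic T}] supplies one for an
   arbitrary [T]. *)
have finA : finite_set (A : set {classic T}) by exists n.
have finAB : finite_set (A `&` B : set {classic T}) by exists p.
have finD : finite_set (A `\` B : set {classic T}) by exact: finite_setD.
have /= := finmap.cardfsID (fset_set (A `&` B : set {classic T}))
                        (fset_set (A : set {classic T})).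
rewrite -fset_setI // -fset_setD // setIA setIid.
have -> : (A : set {classic T}) `\` (A `&` B) = A `\` B.
  by apply/seteqP; split=> x /=; tauto.
rewrite (@card_fset_set {classic T} _ _ An) (@card_fset_set {classic T} _ _ ABp).
case: (finD) => q Dq; rewrite (@card_fset_set {classic T} _ _ Dq) => pqn.
split; first by lia.
by have -> : n - p = q by lia.
Qed.

Lemma card_II_sub_eq (T : Type) (A B : set T) (n : nat) :
  A `<=` B -> (A #= `I_n)%card -> (B #= `I_n)%card -> A = B.
Proof.
move=> AB An Bn; have BAn : (B `&` A #= `I_n)%card by rewrite setIidr.
have [_] := card_setD_II Bn BAn.
by rewrite subnn II0 card_eq0 => /eqP; rewrite setD_eq0 => BA; apply/seteqP.
Qed.

(** To be used with [P] and [Q] the neighbourhoods in [L] of twins of [D]. As [P] and [Q] meet only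
    inside [D], the sets [D], [P \ D], [Q \ D] are disjoint, of sizes [mu], [lam - k1], [lam - k1].
    These add up to [k], so they cover [L], and a vertex outside [D] lies in exactly one of [P] and
    [Q]. *)
Lemma twin_count (T : Type) (L D P Q : set T) (k mu lam k1 : nat) :
  k + 2 * k1 = mu + 2 * lam ->
  D `<=` L -> P `<=` L -> Q `<=` L ->
  (L #= `I_k)%card -> (D #= `I_mu)%card ->
  (P #= `I_lam)%card -> (Q #= `I_lam)%card -> (P `&` Q #= `I_k1)%card ->
  D `&` P = D `&` Q -> (D `&` P #= `I_k1)%card ->
  D = [set s | L s /\ (P s <-> Q s)].
Proof.
move=> keq DL PL QL Lk Dmu Plam Qlam PQ DPQ DP.
have PQD : P `&` Q = D `&` P.
  apply/esym/(card_II_sub_eq _ DP PQ) => s DPs.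
  by split; [case: DPs | move: DPs; rewrite DPQ => -[]].
have [_ LDc] : mu <= k /\ (L `\` D #= `I_(k - mu))%card.
  by apply: card_setD_II => //; rewrite setIidr.
have [k1lam PDc] : k1 <= lam /\ (P `\` D #= `I_(lam - k1))%card.
  by apply: card_setD_II => //; rewrite setIC.
have [_ QDc] : k1 <= lam /\ (Q `\` D #= `I_(lam - k1))%card.
  by apply: card_setD_II => //; rewrite setIC -DPQ.
have [_ LDPc] : lam - k1 <= k - mu /\
    (L `\` D `\` P #= `I_(k - mu - (lam - k1)))%card.
  apply: card_setD_II => //; suff -> : (L `\` D) `&` P = P `\` D by [].
  by apply/seteqP; split=> s /=; [case=> -[] | case=> /[dup] /PL].
have [_] : lam - k1 <= k - mu - (lam - k1) /\
    (L `\` D `\` P `\` Q #= `I_(k - mu - (lam - k1) - (lam - k1)))%card.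
  apply: card_setD_II => //; suff -> : (L `\` D `\` P) `&` Q = Q `\` D by [].
  apply/seteqP; split=> s /=; first by case=> -[[]].
  case=> Qs nD; split=> //; split; first by split=> //; apply: QL.
  move=> Ps; have : (P `&` Q) s by [].
  by rewrite PQD => -[].
(* The valency equation, read as [k = mu + 2 * (lam - k1)]; [k1lam] keeps the truncated subtraction
   exact. *)
have -> : k - mu - (lam - k1) - (lam - k1) = 0 by lia.
rewrite II0 card_eq0 => /eqP cover.
apply/seteqP; split=> [s Ds|s [Ls sPQ]] /=.
  split; first exact: DL.
  have : (D `&` P) s <-> (D `&` Q) s by rewrite DPQ.
  by move=> [DPs DQs]; split=> Hs; [case: DPs | case: DQs].
apply: contrapT => nD; have [Ps|nP] := pselect (P s).
  have : (P `&` Q) s by split=> //; apply/sPQ.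
  by rewrite PQD => -[].
have : (L `\` D `\` P `\` Q) s by split=> // /sPQ.
by rewrite cover.
Qed.

(** * Embedded copies of a graph, and twins in them *)

Definition embedding (S G : graph) (h : S -> G) : Prop :=
  injective h /\ forall x y, adj x y <-> adj (h x) (h y).

(** This replaces an isomorphism with an induced subgraph, so that all later work is with subsets of
    [G] instead of subtypes. *)
Definition copy (S G : graph) (A : set G) : Prop :=
  exists2 h : S -> G, embedding h & range h = A.

Lemma copy_iso (S G : graph) (A : set G) :
  graph_iso (induced A) S -> copy S A.
Proof.
case=> f [[g fK gK] fadj]; exists (fun s => val (g s)).
  split=> [s t /val_inj /(can_inj gK) //|s t].
  by rewrite -{1}(gK s) -{1}(gK t) -fadj.
apply/seteqP; split=> [_ [s _ <-]|a Aa]; first exact: set_valP.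
by exists (f (SigSub (mem_set Aa))) => //; rewrite fK.
Qed.

Lemma card_embedding (S G : graph) (h : S -> G) (A : set S) :
  embedding h -> (h @` A #= A)%card.
Proof. by move=> [hinj _]; apply: inj_card_eq => s t _ _; exact: hinj. Qed.

Lemma embedding_setI (S G : graph) (h : S -> G) (A B : set S) :
  embedding h -> h @` (A `&` B) = h @` A `&` h @` B.
Proof.
move=> [hinj _]; apply/seteqP; split=> [_ [s [As Bs] <-]|_ [[s As <-]]].
  by split; exists s.
by case=> t Bt /hinj ts; exists s => //; split=> //; rewrite -ts.
Qed.

Lemma embedding_image_inj (S G : graph) (h : S -> G) (A B : set S) :
  embedding h -> h @` A = h @` B -> A = B.
Proof.
by move=> [hinj _] AB; apply/seteqP; split=> s;
  rewrite -(image_inj hinj) (AB, esym AB) (image_inj hinj).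
Qed.

Lemma embedding_nbhd (S G : graph) (h : S -> G) (s : S) :
  embedding h -> h @` nbhd s = range h `&` nbhd (h s).
Proof.
move=> [_ hadj]; apply/seteqP; split=> [_ [t /hadj st <-]|_ [[t _ <-] /hadj st]].
  by split=> //; exists t.
by exists t.
Qed.

Lemma embedding_nbhdI (S G : graph) (h : S -> G) (s t : S) :
  embedding h ->
  h @` (nbhd s `&` nbhd t) = range h `&` nbhd (h s) `&` nbhd (h t).
Proof.
move=> eh; rewrite embedding_setI // !embedding_nbhd //.
by rewrite setIACA setIid setIA.
Qed.

Lemma copy_image (S1 S G : graph) (h : S -> G) (A : set S) :
  embedding h -> copy S1 A -> copy S1 (h @` A).
Proof.
move=> [hinj hadj] [g [ginj gadj] <-]; exists (h \o g); last by rewrite image_comp.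
by split=> [|s t]; [exact: inj_comp | rewrite gadj hadj].
Qed.

(** Distance two is measured in the ambient graph [G], whereas the neighbourhoods are compared
    inside [C]. *)
Definition twin (G : graph) (C : set G) (y z : G) : Prop :=
  [/\ C z, sphere 2 y z & C `&` nbhd y = C `&` nbhd z].

Lemma copy_card (Del G : graph) (C : set G) :
  copy Del C -> (C #= [set: Del])%card.
Proof. by case=> h eh <-; exact: card_embedding. Qed.

Lemma copy_valency (Del G : graph) (C : set G) (k1 : nat) (y : G) :
  regular Del k1 -> copy Del C -> C y -> (C `&` nbhd y #= `I_k1)%card.
Proof.
move=> Dreg [h eh <-] [d _ <-]; rewrite -embedding_nbhd //.
exact: card_eq_trans (card_embedding _ eh) (Dreg d).
Qed.

Lemma copy_twin (Del G : graph) (C : set G) (y : G) :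
  (forall d : Del, exists! e : Del, sphere 2 d e /\ nbhd d = nbhd e) ->
  copy Del C -> C y -> exists z, twin C y z.
Proof.
move=> Dtwin [h eh <-] [d _ <-]; have [hinj hadj] := eh.
have [e [[/sphere2P[de nde [t [dt et]]] tw] _]] := Dtwin d.
exists (h e); split; [by exists e | | by rewrite -!embedding_nbhd // tw].
apply/sphere2P; split; [by move/hinj | by move/hadj |].
by exists (h t); split; apply/hadj.
Qed.

Lemma copy_twin_unique (Del G : graph) (C : set G) (y z z' : G) :
  (forall d : Del, exists! e : Del, sphere 2 d e /\ nbhd d = nbhd e) ->
  copy Del C -> C y -> twin C y z -> twin C y z' -> z = z'.
Proof.
move=> Dtwin [h eh <-] [d _ <-]; have [hinj hadj] := eh.
have dtwin e : twin (range h) (h d) (h e) -> sphere 2 d e /\ nbhd d = nbhd e.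
  case=> _ /sphere2P[de nde _]; rewrite -!embedding_nbhd // => tw.
  have {}tw : nbhd d = nbhd e by apply: embedding_image_inj tw.
  split=> //; apply/sphere2P; split=> [ed||]; [by rewrite ed in de | by move/hadj |].
  (* The common neighbour must be found in [Del] itself. Since [d] has some twin at distance two, it
     has a neighbour [t], which [e] shares by [tw]. *)
  have [f [[/sphere2P[_ _ [t [dt _]]] _] _]] := Dtwin d.
  by exists t; split=> //; rewrite -tw.
move=> twz twz'; have [[e _ ez] _ _] := twz; have [[e' _ ez'] _ _] := twz'.
rewrite -{}ez -{}ez' in twz twz' *.
have [f [_ uniq]] := Dtwin d.
by rewrite -(uniq _ (dtwin _ twz)) -(uniq _ (dtwin _ twz')).
Qed.

(** Otherwise [s] would be the only vertex outside [nbhd s], whence [n - k = 1], against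
    [k < n - 1]. *)
Lemma srg_nonadjacent (S : graph) (n k lam mu : nat) (s : S) :
  strongly_regular S n k lam mu -> exists2 t, s <> t & ~ adj s t.
Proof.
case=> Sn kn Sk _ _; apply: contrapT => compl.
have [_] : k <= n /\ ([set: S] `\` nbhd s #= `I_(n - k))%card.
  by apply: card_setD_II => //; rewrite setTI; exact: Sk.
have -> : [set: S] `\` nbhd s = [set s].
  apply/seteqP; split=> [t [_ nst]|_ ->] /=; last by split=> //; exact: adj_irrefl.
  by apply: contrapT => ts; apply: compl; exists t => // st; apply: ts.
rewrite card_eq_sym => /card_eq_trans /(_ card_set1) /card_eq_II.
by lia.
Qed.

(** * Local structure of [Gam] *)

Section LocalGraph.
Variables (Gam Sig Del : graph) (n k lam mu k1 : nat).
Hypothesis Gam_locally_Sig : locally Gam Sig.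
Hypothesis mu_graphs :
  forall u w : Sig, sphere 2 u w -> graph_iso (mu_graph u w) Del.
Hypothesis Sig_srg : strongly_regular Sig n k lam mu.
Hypothesis mu_gt0 : 0 < mu.
Hypothesis Del_regular : regular Del k1.
Implicit Types (u v w y z : Gam) (C : set Gam).

Lemma nbhd_copy u : copy Sig (nbhd u).
Proof. by apply: copy_iso; case: (Gam_locally_Sig u). Qed.

Lemma local_valency u v : adj u v -> (nbhd u `&` nbhd v #= `I_k)%card.
Proof.
have [_ _ Sk _ _] := Sig_srg.
by apply: (copy_valency Sk); exact: nbhd_copy.
Qed.

Lemma local_lambda u v w : adj u v -> adj u w -> adj v w ->
  (nbhd u `&` nbhd v `&` nbhd w #= `I_lam)%card.
Proof.
have [h eh hu] := nbhd_copy u; have [_ _ _ Slam _] := Sig_srg.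
move=> uv uw; have [s _ sv] : range h v by rewrite hu.
have [t _ tw] : range h w by rewrite hu.
rewrite -sv -tw -hu => /(eh.2 _ _) st; rewrite -embedding_nbhdI //.
exact: card_eq_trans (card_embedding _ eh) (Slam _ _ st).
Qed.

Lemma srg_sphere2 (s t : Sig) : s <> t -> ~ adj s t -> sphere 2 s t.
Proof.
have [_ _ _ _ Smu] := Sig_srg => st nst; apply/sphere2P; split=> //.
apply/set0P/eqP => st0; have := Smu _ _ st nst; rewrite st0.
rewrite card_eq_sym card_eq0 => /eqP I0.
by have : `I_mu 0 := mu_gt0; rewrite I0.
Qed.

(** A nonadjacent pair of [Sig] provides an actual mu-graph: it has [mu] vertices and is isomorphic
    to [Del]. *)
Lemma Del_card : nonempty_graph Sig -> ([set: Del] #= `I_mu)%card.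
Proof.
case=> s _; have [t st nst] := srg_nonadjacent s Sig_srg.
have /copy_iso/copy_card := mu_graphs (srg_sphere2 st nst).
rewrite card_eq_sym => /card_eq_trans; apply.
by have [_ _ _ _ Smu] := Sig_srg; exact: Smu.
Qed.

Lemma local_mu_graph u v w : adj u v -> adj u w -> v <> w -> ~ adj v w ->
  copy Del (nbhd u `&` nbhd v `&` nbhd w).
Proof.
have [h eh hu] := nbhd_copy u; move=> uv uw.
have [s _ <-] : range h v by rewrite hu.
have [t _ <-] : range h w by rewrite hu.
move=> vw nvw; rewrite -hu -embedding_nbhdI //; apply: copy_image => //.
apply/copy_iso/mu_graphs/srg_sphere2; first by move=> st; rewrite st in vw.
by move/(eh.2 _ _).
Qed.

(** The set [nbhd u & nbhd y & nbhd z] is again a copy of [Del], and it contains [v]. Both sides are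
    thus neighbourhoods of a vertex in a copy of [Del], of size [k1], and the left one is contained
    in the right one because [y] and [z] are twins. *)
Lemma twin_nbhdI u v y z C :
  adj u v -> C `<=` nbhd u `&` nbhd v -> copy Del C -> C y -> twin C y z ->
  C `&` nbhd y = nbhd u `&` nbhd y `&` nbhd z `&` nbhd v.
Proof.
move=> uv CL Ccopy Cy [Cz /sphere2P[yz nyz _] tw].
have [[uy vy] [uz vz]] := (CL _ Cy, CL _ Cz).
apply: card_II_sub_eq (copy_valency Del_regular Ccopy Cy) _.
  move=> s /[dup]; rewrite {2}tw => -[Cs ys] [_ zs].
  by have [us vs] := CL _ Cs.
apply: copy_valency Del_regular (local_mu_graph uy uz yz nyz) _.
by split; [split=> //|]; apply: adj_sym.
Qed.

Hypothesis Sig_nonempty : nonempty_graph Sig.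
Hypothesis valency : k + 2 * k1 = mu + 2 * lam.

(** The right-hand side does not mention [C]: two copies of [Del] in [nbhd u & nbhd v] sharing one
    pair of twins coincide. The size of [P & Q] required by [twin_count] comes from [twin_nbhdI]. *)
Lemma twin_determines u v y z C :
  adj u v -> C `<=` nbhd u `&` nbhd v -> copy Del C -> C y -> twin C y z ->
  C = [set s | (nbhd u `&` nbhd v) s /\ (adj y s <-> adj z s)].
Proof.
move=> uv CL Ccopy Cy twz; have [Cz _ tw] := twz.
have [[uy vy] [uz vz]] := (CL _ Cy, CL _ Cz).
have CI t : C `&` (nbhd u `&` nbhd v `&` nbhd t) = C `&` nbhd t.
  by rewrite setIA (setIidl CL).
have PQ : nbhd u `&` nbhd v `&` nbhd y `&` (nbhd u `&` nbhd v `&` nbhd z) =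
          nbhd u `&` nbhd y `&` nbhd z `&` nbhd v.
  by apply/seteqP; split=> s /=; tauto.
have Ck1 := copy_valency Del_regular Ccopy Cy.
rewrite (@twin_count _ (nbhd u `&` nbhd v) C (nbhd u `&` nbhd v `&` nbhd y)
  (nbhd u `&` nbhd v `&` nbhd z) _ _ _ _ valency) //; rewrite ?CI //.
- by apply/seteqP; split=> s /=; tauto.
- exact: local_valency.
- exact: card_eq_trans (copy_card Ccopy) (Del_card Sig_nonempty).
- exact: local_lambda.
- exact: local_lambda.
- by rewrite PQ -(twin_nbhdI uv CL Ccopy Cy twz).
Qed.

Hypothesis Del_nonempty : nonempty_graph Del.
Hypothesis Del_twin : forall y : Del,
  exists! z : Del, sphere 2 y z /\ nbhd y = nbhd z.

Lemma mu_graph_unique_apex u v C :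
  adj u v -> C `<=` nbhd u `&` nbhd v -> copy Del C ->
  exists! x, (nbhd u `&` sphere 2 v) x /\ C = nbhd u `&` nbhd v `&` nbhd x.
Proof.
move=> uv CL Ccopy.
have [y Cy] : C !=set0.
  have [[d _] [h _ <-]] := (Del_nonempty, Ccopy).
  by exists (h d), d.
have [z twz] := copy_twin Del_twin Ccopy Cy; have [Cz sph tw] := twz.
have [yz nyz _] := (sphere2P _ _).1 sph.
have [[uy vy] [uz vz]] := (CL _ Cy, CL _ Cz).
set M := nbhd u `&` nbhd y `&` nbhd z.
have Mcopy : copy Del M by exact: local_mu_graph.
have Mv : M v by split; [split=> //|]; apply: adj_sym.
have CM : C `&` nbhd y = M `&` nbhd v by exact: twin_nbhdI twz.
(* The apex is the twin of [v] in [M]. *)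
have [x twx] := copy_twin Del_twin Mcopy Mv.
have [[[ux yx] zx] sphx Mtw] := twx; have [vx nvx _] := (sphere2P _ _).1 sphx.
exists x; split=> [|x' [[ux' sphx'] Cx']].
  split=> //; set C' := _ `&` nbhd x.
  have C'copy : copy Del C' by exact: local_mu_graph.
  have C'y : C' y by split=> //; apply: adj_sym.
  have C'z : C' z by split=> //; apply: adj_sym.
  have Mk1 := copy_valency Del_regular Mcopy Mv.
  (* A vertex of [M] adjacent to [v] is adjacent to the twin [x] too, hence lies in [C']; both sides
     have size [k1]. With [t] equal to [y] and to [z], this makes [y] and [z] twins in [C']. *)
  have MC' t : C' t -> M `<=` nbhd t -> M `&` nbhd v = C' `&` nbhd t.
    move=> C't Mt; apply: card_II_sub_eq Mk1 _; last exact: copy_valency C't.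
    move=> s /[dup]; rewrite {2}Mtw => -[Ms vs] [_ xs].
    by split; [split=> //; split=> //; case: Ms => -[] | exact: Mt].
  have twz' : twin C' y z.
    by split=> //; rewrite -!MC' // => s [[]].
  rewrite (twin_determines uv CL Ccopy Cy twz).
  by rewrite -(twin_determines uv _ C'copy C'y twz') // => s [].
(* Uniqueness: [x'] is adjacent to [y] and [z], so it lies in [M], and it remains to show that it is
   a twin of [v] there. *)
have [[_ x'y] [_ x'z]] : (nbhd u `&` nbhd v `&` nbhd x') y /\
    (nbhd u `&` nbhd v `&` nbhd x') z by rewrite -Cx'.
have Mx' : M x' by split; [split=> //|]; apply: adj_sym.
apply: (copy_twin_unique Del_twin Mcopy Mv twx); split=> //.
(* By [CM], the neighbours of [v] in [M] lie in [C], hence are adjacent to [x']; equal valencies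
   turn this inclusion into equality. *)
apply: card_II_sub_eq (copy_valency Del_regular Mcopy Mv)
  (copy_valency Del_regular Mcopy Mx') => s /[dup] -[Ms _].
by rewrite -CM Cx' => -[[_ x's] _].
Qed.

End LocalGraph.

Theorem lemma4p4 (Gam Sig Del : graph) (n k lam mu k1 : nat)
  (Gam_nonempty : nonempty_graph Gam)
  (Sig_nonempty : nonempty_graph Sig)
  (Del_nonempty : nonempty_graph Del)
  (Gam_locally_Sig : locally Gam Sig)
  (mu_graphs : forall u w : Sig, sphere 2 u w -> graph_iso (mu_graph u w) Del)
  (Sig_srg : strongly_regular Sig n k lam mu)
  (mu_gt0 : 0 < mu)
  (Del_regular : regular Del k1)
  (Del_twin : forall y : Del,
     exists! z : Del, sphere 2 y z /\ nbhd y = nbhd z)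
  (valency : (k%:Z = mu%:Z + 2 * lam%:Z - 2 * k1%:Z)%R) :
  unique_x_property Gam.
Proof.
(* The integer equation passes to naturals with the negative term moved across, which avoids
   truncation. *)
have valN : k + 2 * k1 = mu + 2 * lam by lia.
have [s _] := Sig_nonempty; have [t st nst] := srg_nonadjacent s Sig_srg.
(* The vertex [v] is arbitrary; a nonadjacent pair of [Sig], carried into [nbhd v], gives [u] and
   [w]. *)
have [v _] := Gam_nonempty; have [h eh hv] := nbhd_copy Gam_locally_Sig v.
have vu : adj v (h s) by have : nbhd v (h s) by rewrite -hv; exists s.
have vw : adj v (h t) by have : nbhd v (h t) by rewrite -hv; exists t.
have uw : h s <> h t by move/eh.1.
have nuw : ~ adj (h s) (h t) by move/(eh.2 _ _).
split; first by move=> compl; apply/nuw/compl.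
exists (h s), v, (h t); split; first exact: adj_sym.
  split=> //; apply/sphere2P; split=> //.
  by exists v; split; exact: adj_sym.
apply: (mu_graph_unique_apex Gam_locally_Sig mu_graphs Sig_srg) => //.
- exact: adj_sym.
(* Seen from [v], the triple intersection is the mu-graph of the nonadjacent pair [h s], [h t] in
   [nbhd v]. *)
- by rewrite (setIC (nbhd (h s))); exact: (local_mu_graph _ _ Sig_srg).
Qed.
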